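(* Consider the problem $\min_{\mathbf{x}\in\mathbb{R}^{n_1},\,\mathbf{y}\in\mathbb{R}^{n_2}} f(\mathbf{x})+g(\mathbf{y})$ subject to $\mathbf{h}(\mathbf{x})\le B\mathbf{y}$ and $A\mathbf{x}+C\mathbf{y}=\mathbf{d}$ (data as in the context). Let $\beta_1,\beta_2>0$ and $\gamma_1,\gamma_2\in\left(0,\frac{1+\sqrt5}{2}\right)$. Assume that there exists a KKT point $(\mathbf{x}^*,\mathbf{y}^*,\mathbf{u}_1^*,\mathbf{u}_2^* )$ as defined in the context. Let $\{(\mathbf{x}^k,\mathbf{s}^k,\mathbf{y}^k,\mathbf{u}_1^k,\mathbf{u}_2^k)\}_{k\ge1}$ be a sequence generated by the NL-ADMM algorithm described in the context with these parameters. Then $$\lim_{k\to\infty}\Big(\big\|[\mathbf{h}(\mathbf{x}^k)-B\mathbf{y}^k]_+\big\|+\big\|A\mathbf{x}^k+C\mathbf{y}^k-\mathbf{d}\big\|\Big)=0$$ and $$\lim_{k\to\infty}\Big(f(\mathbf{x}^k)+g(\mathbf{y}^k)-\big(f(\mathbf{x}^* )+g(\mathbf{y}^* )\big)\Big)=0.$$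
   Context: Setting: $f:\mathbb{R}^{n_1}\to\mathbb{R}\cup\{+\infty\}$ and $g:\mathbb{R}^{n_2}\to\mathbb{R}\cup\{+\infty\}$ are proper closed convex functions (possibly nondifferentiable); $\mathbf{h}=[h_1;\ldots;h_{m_1}]:\mathbb{R}^{n_1}\to\mathbb{R}^{m_1}$ has each component $h_j:\mathbb{R}^{n_1}\to\mathbb{R}$ convex (not necessarily differentiable); $A\in\mathbb{R}^{m_2\times n_1}$, $B\in\mathbb{R}^{m_1\times n_2}$, $C\in\mathbb{R}^{m_2\times n_2}$, $\mathbf{d}\in\mathbb{R}^{m_2}$. $\|\cdot\|$ is the Euclidean norm, $[\cdot]_+=\max\{\cdot,0\}$ componentwise, vector inequalities are componentwise, $\odot$ is the componentwise product, $\partial$ of a convex function is its convex subdifferential, and $\partial\mathbf{h}(\mathbf{x})=\{[\mathbf{z}_1,\ldots,\mathbf{z}_{m_1}]^\top:\mathbf{z}_j\in\partial h_j(\mathbf{x})\ \forall j\}$. KKT point: $(\mathbf{x}^*,\mathbf{y}^*,\mathbf{u}_1^*,\mathbf{u}_2^* )$ is a KKT point (for the given $\beta_1,\beta_2>0$) if $\mathbf{0}\in\partial f(\mathbf{x}^* )+\beta_1\,\partial\mathbf{h}(\mathbf{x}^* )^\top\mathbf{u}_1^*+\beta_2A^\top\mathbf{u}_2^*$ (i.e. this holds for some matrix in $\partial\mathbf{h}(\mathbf{x}^* )$); $\mathbf{0}\in\partial g(\mathbf{y}^* )-\beta_1B^\top\mathbf{u}_1^*+\beta_2C^\top\mathbf{u}_2^*$;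 $\mathbf{h}(\mathbf{x}^* )\le B\mathbf{y}^*$, $A\mathbf{x}^*+C\mathbf{y}^*=\mathbf{d}$, $\mathbf{u}_1^*\ge\mathbf{0}$; and $\mathbf{u}_1^*\odot(\mathbf{h}(\mathbf{x}^* )-B\mathbf{y}^* )=\mathbf{0}$. NL-ADMM algorithm: choose $\mathbf{y}^0\in\mathbb{R}^{n_2}$, $\mathbf{u}_1^0\in\mathbb{R}^{m_1}$ with $\mathbf{u}_1^0\ge\mathbf{0}$, and $\mathbf{u}_2^0\in\mathbb{R}^{m_2}$. For $k=0,1,2,\ldots$ (never stopping), take - $\mathbf{x}^{k+1}$ a minimizer over $\mathbf{x}$ of $f(\mathbf{x})+\frac{\beta_1}{2}\|[\mathbf{h}(\mathbf{x})-B\mathbf{y}^k+\mathbf{u}_1^k]_+\|^2+\frac{\beta_2}{2}\|A\mathbf{x}+C\mathbf{y}^k-\mathbf{d}+\mathbf{u}_2^k\|^2$; - $\mathbf{s}^{k+1}=[-\mathbf{h}(\mathbf{x}^{k+1})+B\mathbf{y}^k-\mathbf{u}_1^k]_+$; - $\mathbf{y}^{k+1}$ a minimizer over $\mathbf{y}$ of $g(\mathbf{y})+\frac{\beta_1}{2}\|\mathbf{h}(\mathbf{x}^{k+1})+\mathbf{s}^{k+1}-B\mathbf{y}+\mathbf{u}_1^k\|^2+\frac{\beta_2}{2}\|A\mathbf{x}^{k+1}+C\mathbf{y}-\mathbf{d}+\mathbf{u}_2^k\|^2$; - $\mathbf{u}_1^{k+1}=\mathbf{u}_1^k+\gamma_1(\mathbf{h}(\mathbf{x}^{k+1})+\mathbf{s}^{k+1}-B\mathbf{y}^{k+1})$;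 - $\mathbf{u}_2^{k+1}=\mathbf{u}_2^k+\gamma_2(A\mathbf{x}^{k+1}+C\mathbf{y}^{k+1}-\mathbf{d})$. A sequence is ''generated by the algorithm'' if it satisfies these relations for all $k\ge0$; in particular the minimizers are assumed to exist (they need not be unique). *)

(* Defs.v *)
From mathcomp Require Import all_boot all_order all_algebra.
From mathcomp Require Import all_classical all_reals all_analysis.

Set Implicit Arguments.
Unset Strict Implicit.
Unset Printing Implicit Defensive.

Import Order.TTheory GRing.Theory Num.Theory.
Import numFieldNormedType.Exports.

Local Open Scope classical_set_scope.
Local Open Scope ring_scope.

Definition dotv (R : realType) (n : nat) (u v : 'cV[R]_n) : R :=
  \sum_i u i 0 * v i 0.

(* The library norm on matrices is the sup norm, hence this definition. *)
Definition norm2 (R : realType) (n : nat) (v : 'cV[R]_n) : R :=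
  Num.sqrt (dotv v v).

Definition posv (R : realType) (n : nat) (v : 'cV[R]_n) : 'cV[R]_n :=
  map_mx (fun a => Num.max a 0) v.

Definition lev (R : realType) (n : nat) (u v : 'cV[R]_n) : Prop :=
  forall i, u i 0 <= v i 0.

Definition hadamard (R : realType) (n : nat) (u v : 'cV[R]_n) : 'cV[R]_n :=
  map2_mx *%R u v.

Definition epigraph (R : realType) (n : nat) (f : 'cV[R]_n -> \bar R) :
    set ('cV[R]_n * R^o) :=
  [set p | (f p.1 <= (p.2 : R)%:E)%E].

Definition proper (R : realType) (n : nat) (f : 'cV[R]_n -> \bar R) : Prop :=
  (forall x, f x != -oo%E) /\ (exists x, f x != +oo%E).

Definition proper_closed_convex (R : realType) (n : nat)
    (f : 'cV[R]_n -> \bar R) : Prop :=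
  [/\ proper f, closed (epigraph f) & convex_set (epigraph f)].

Definition convex_map (R : realType) (n m : nat) (h : 'cV[R]_n -> 'cV[R]_m) :
    Prop :=
  forall j, convex_function setT (fun x : 'cV[R]_n => h x j 0).

(* For a proper f, the set is empty where f takes the value +oo. *)
Definition subdifferential (R : realType) (n : nat) (f : 'cV[R]_n -> \bar R)
    (x : 'cV[R]_n) : set 'cV[R]_n :=
  [set v | forall z, (f x + (dotv v (z - x))%:E <= f z)%E].

Definition subdifferential_map (R : realType) (n m : nat)
    (h : 'cV[R]_n -> 'cV[R]_m) (x : 'cV[R]_n) : set 'M[R]_(m, n) :=
  [set J | forall j, subdifferential (fun z => (h z j 0)%:E) x (row j J)^T].

Definition is_minimizer (R : realType) (n : nat) (F : 'cV[R]_n -> \bar R)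
    (x : 'cV[R]_n) : Prop :=
  forall z, (F x <= F z)%E.

Record KKT (R : realType) (n1 n2 m1 m2 : nat)
    (f : 'cV[R]_n1 -> \bar R) (g : 'cV[R]_n2 -> \bar R)
    (h : 'cV[R]_n1 -> 'cV[R]_m1)
    (A : 'M[R]_(m2, n1)) (B : 'M[R]_(m1, n2)) (C : 'M[R]_(m2, n2))
    (d : 'cV[R]_m2) (beta1 beta2 : R)
    (x : 'cV[R]_n1) (y : 'cV[R]_n2) (u1 : 'cV[R]_m1) (u2 : 'cV[R]_m2) :
    Prop := {
  KKT_x : exists (v : 'cV[R]_n1) (J : 'M[R]_(m1, n1)),
    [/\ subdifferential f x v, subdifferential_map h x J &
        0 = v + beta1 *: (J^T *m u1) + beta2 *: (A^T *m u2)] ;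
  KKT_y : exists2 w : 'cV[R]_n2, subdifferential g y w &
    0 = w - beta1 *: (B^T *m u1) + beta2 *: (C^T *m u2) ;
  KKT_ineq : lev (h x) (B *m y) ;
  KKT_eq : A *m x + C *m y = d ;
  KKT_dual : lev 0 u1 ;
  KKT_slack : hadamard u1 (h x - B *m y) = 0
}.

(* x 0 and s 0 are not part of the algorithm and are left arbitrary. *)
Record NLADMM (R : realType) (n1 n2 m1 m2 : nat)
    (f : 'cV[R]_n1 -> \bar R) (g : 'cV[R]_n2 -> \bar R)
    (h : 'cV[R]_n1 -> 'cV[R]_m1)
    (A : 'M[R]_(m2, n1)) (B : 'M[R]_(m1, n2)) (C : 'M[R]_(m2, n2))
    (d : 'cV[R]_m2) (beta1 beta2 gamma1 gamma2 : R)
    (x : nat -> 'cV[R]_n1) (s : nat -> 'cV[R]_m1) (y : nat -> 'cV[R]_n2)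
    (u1 : nat -> 'cV[R]_m1) (u2 : nat -> 'cV[R]_m2) : Prop := {
  NLADMM_init : lev 0 (u1 0%N) ;
  NLADMM_x : forall k, is_minimizer
    (fun z => f z
       + (beta1 / 2 * norm2 (posv (h z - B *m y k + u1 k)) ^+ 2
          + beta2 / 2 * norm2 (A *m z + C *m y k - d + u2 k) ^+ 2)%:E)%E
    (x k.+1) ;
  NLADMM_s : forall k, s k.+1 = posv (- h (x k.+1) + B *m y k - u1 k) ;
  NLADMM_y : forall k, is_minimizer
    (fun z => g z
       + (beta1 / 2 * norm2 (h (x k.+1) + s k.+1 - B *m z + u1 k) ^+ 2
          + beta2 / 2 * norm2 (A *m x k.+1 + C *m z - d + u2 k) ^+ 2)%:E)%E
    (y k.+1) ;
  NLADMM_u1 : forall k,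
    u1 k.+1 = u1 k + gamma1 *: (h (x k.+1) + s k.+1 - B *m y k.+1) ;
  NLADMM_u2 : forall k,
    u2 k.+1 = u2 k + gamma2 *: (A *m x k.+1 + C *m y k.+1 - d)
}.

(* Main.v *)
Require Import Defs.
From mathcomp Require Import all_boot all_order all_algebra.
From mathcomp Require Import all_classical all_reals all_analysis.
From mathcomp Require Import ring lra.

Import Order.TTheory GRing.Theory Num.Theory.
Import numFieldNormedType.Exports.

Local Open Scope classical_set_scope.
Local Open Scope ring_scope.

(** The method is a two-block ADMM for the constraints h(x) + s = B y,
    s >= 0, and A x + C y = d, with u1 and u2 as scaled multipliers.  The
    first equality is not affine, yet the classical analysis survives: the
    x-step acts with the multiplier p = [h(x+) - B y + u1]_+, which is
    nonnegative, so that the pairing of p with h is convex, and complementary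
    to s+, so that s+ is the best nonnegative slack for p.

    Both constraints are handled coordinate by coordinate over the index type
    'I_m1 + 'I_m2, with weights beta and relaxation factors gamma depending on
    the block.  Write r for the residual (h(x) + s - B y, A x + C y - d) and v
    for (B y, - C y): then r = (h(x) + s, A x - d) - v in both blocks, and the
    multiplier of the x-step is r+ + u + (v+ - v).
    With G the difference between the objective at the iterate and at the KKT
    point, three inequalities drive the proof:
    - the saddle point property of the KKT point bounds G+ from below by
      - sum beta u* r+ (KKT_gap_lower_bound);
    - the optimality of the two subproblems, tested at x* and y*, bounds G+
      from above by
      - sum beta (r+^2 + u r+ + (v+ - v) r+ + (v+ - v)(v+ - v* ));
    - the optimality of two successive y-steps, each tested at the other's
      solution, gives
      sum beta (r+ - (1 - gamma) r)(v+ - v) >= 0.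

    Completing squares, they make the function
      sum beta ((u - u* )^2 / gamma + (v - v* )^2 + c r^2)
    decrease by at least a positive combination of the r+^2 and (v+ - v)^2
    (admm_coordinate_descent), provided (1 - gamma)^2 < c < 2 - gamma.  Such a
    c exists exactly when gamma is below the golden ratio.  Hence u and v stay
    bounded while r and v+ - v vanish, and both bounds on G tend to 0
    (admm_lyapunov). *)

(** * Sequences converging to zero *)

Lemma cvg0_sqr_le (R : realType) (a e : R^nat) :
  (forall k, a k ^+ 2 <= e k) -> e @ \oo --> 0 -> a @ \oo --> 0.
Proof.
move=> ae e0; apply/cvgr0Pnorm_le => /= eps eps0.
near=> k.
rewrite -(@ler_pXn2r _ 2)// ?nnegrE// ?(ltW eps0)//.
rewrite real_normK ?num_real//; apply: (le_trans (ae k)).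
apply: le_trans (ler_norm _) _; near: k.
exact: (cvgr0Pnorm_le e).1 e0 _ (exprn_gt0 2 eps0).
Unshelve. all: by end_near.
Qed.

Lemma cvg0_mul_bounded (R : realType) (K : R) (a b : R^nat) :
  (forall k, a k ^+ 2 <= K) -> b @ \oo --> 0 -> a \* b @ \oo --> 0.
Proof.
move=> aK b0; apply: (@cvg0_sqr_le _ _ (fun k => K * b k * b k)) => [k|].
  by rewrite /= exprMn -mulrA -expr2 ler_wpM2r// sqr_ge0.
rewrite -[X in _ --> X](mulr0 (K * 0)).
by apply: cvgM => //; apply: cvgM => //; exact: cvg_cst.
Qed.

(** A Lyapunov function is monotone and bounded below, hence convergent, so its
    decrements vanish. *)
Lemma cvg0_descent (R : realType) (W D : R^nat) :
  (forall k, 0 <= W k) -> (forall k, 0 <= D k) ->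
  (forall k, W k.+1 + D k <= W k) ->
  D @ \oo --> 0 /\ forall k, W k <= W 0%N.
Proof.
move=> W0 D0 WD.
have Wni : nonincreasing_seq W.
  apply/nonincreasing_seqP => k; apply: le_trans (WD k).
  by rewrite lerDl.
split; last by move=> k; exact: Wni.
have Wcvg : cvgn W.
  by apply: nonincreasing_is_cvgn => //; exists 0 => _ [k _ <-].
have WS : W k.+1 @[k --> \oo] --> limn W by rewrite (@cvg_shiftS _ W).
apply: (@squeeze_cvgr _ _ _ _ (cst 0) (fun k => W k - W k.+1)).
- by apply: nearW => k; rewrite D0/= lerBrDr addrC WD.
- exact: cvg_cst.
- by rewrite -(subrr (limn W)); exact: cvgB.
Qed.

Lemma cvg0_sum (R : realType) (I : finType) (F : I -> R^nat) :
  (forall i, F i @ \oo --> 0) -> (fun k => \sum_i F i k) @ \oo --> 0.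
Proof.
move=> F0; have := @cvg_big R I +%R 0 xpredT (@add_continuous R) nat _
  (index_enum I) F (fun=> 0) eventually_filter (fun i _ => F0 i).
by rewrite big1.
Qed.

(** * Lyapunov analysis of the iteration *)

(** Both sides differ by g^2 - g - 1, whose positive root is the golden ratio. *)
Lemma golden_ratio_sqr (R : realType) (g : R) :
  0 < g < (1 + Num.sqrt 5) / 2 -> (1 - g) ^+ 2 < 2 - g.
Proof.
move=> /andP[g0 g1].
have s0 : 0 <= Num.sqrt 5 :> R by exact: sqrtr_ge0.
have s2 : Num.sqrt 5 ^+ 2 = 5 :> R by rewrite sqr_sqrtr.
have s1 : 1 < Num.sqrt 5 :> R by nra.
move: (Num.sqrt 5) s0 s2 s1 g1 => s s0 s2 s1 g1.
have : (g - (1 + s) / 2) * (g - (1 - s) / 2) < 0.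
  by rewrite pmulr_llt0; lra.
nra.
Qed.

(** The difference of the two sides is the single square
    c (r + (1 - g) / c (v' - v))^2.  The term c r^2 of the Lyapunov function is
    there to pay for the cross term (1 - g) r (v' - v). *)
Lemma admm_coordinate_descent (R : realType) (g c us vs u r v r' v' : R) :
  0 < g -> 0 < c ->
  ((u + g * r' - us) ^+ 2 / g + (v' - vs) ^+ 2 + c * r' ^+ 2)
  + ((2 - g - c) * r' ^+ 2 + (1 - (1 - g) ^+ 2 / c) * (v' - v) ^+ 2)
  <= ((u - us) ^+ 2 / g + (v - vs) ^+ 2 + c * r ^+ 2)
     + 2 * (r' ^+ 2 + (u - us) * r' + (v' - v) * r' + (v' - v) * (v' - vs))
     - 2 * ((r' - (1 - g) * r) * (v' - v)).
Proof.
move=> g0 c0; rewrite -subr_ge0.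
rewrite (_ : _ - _ = c * (r + (1 - g) / c * (v' - v)) ^+ 2).
  by rewrite mulr_ge0 ?sqr_ge0// ltW.
by field; rewrite !gt_eqF.
Qed.

(** Convergence of ADMM reduced to scalar sequences: once the multiplier update
    is given, the constraints and the objective enter only through the
    monotonicity inequality between successive y-steps and the two bounds on
    the gap. *)
Lemma admm_lyapunov (R : realType) (I : finType) (b g us vs : I -> R)
    (u v r : I -> R^nat) (gap : R^nat) :
  (forall i, 0 < b i) -> (forall i, 0 < g i) ->
  (forall i, (1 - g i) ^+ 2 < 2 - g i) ->
  (forall i k, u i k.+1 = u i k + g i * r i k.+1) ->
  (forall k, 0 <= \sum_i b i * ((r i k.+1 - (1 - g i) * r i k)
                                 * (v i k.+1 - v i k))) ->
  (forall k, - \sum_i b i * (us i * r i k.+1) <= gap k.+1) ->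
  (forall k, gap k.+1 <= - \sum_i b i *
     (r i k.+1 ^+ 2 + u i k * r i k.+1 + (v i k.+1 - v i k) * r i k.+1
      + (v i k.+1 - v i k) * (v i k.+1 - vs i))) ->
  (forall i, r i @ \oo --> 0) /\ gap @ \oo --> 0.
Proof.
move=> b0 g0 gl uS mono lo up.
(* Any value strictly between (1 - g)^2 and 2 - g would do: the midpoint. *)
pose c i := ((1 - g i) ^+ 2 + (2 - g i)) / 2.
have c0 i : 0 < c i.
  by rewrite /c; have := gl i; have := sqr_ge0 (1 - g i); lra.
pose W k := \sum_i b i * ((u i k - us i) ^+ 2 / g i + (v i k - vs i) ^+ 2
                           + c i * r i k ^+ 2).
pose D k := \sum_i b i * ((2 - g i - c i) * r i k.+1 ^+ 2
             + (1 - (1 - g i) ^+ 2 / c i) * (v i k.+1 - v i k) ^+ 2).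
have rc i : 0 < 2 - g i - c i by rewrite /c; have := gl i; lra.
have dc i : 0 < 1 - (1 - g i) ^+ 2 / c i.
  by rewrite subr_gt0 ltr_pdivrMr// mul1r /c; have := gl i; lra.
have Wi0 i k : 0 <= b i * ((u i k - us i) ^+ 2 / g i + (v i k - vs i) ^+ 2
                           + c i * r i k ^+ 2).
  rewrite mulr_ge0 ?(ltW (b0 _))// !addr_ge0 ?sqr_ge0//.
    by rewrite divr_ge0 ?sqr_ge0 ?(ltW (g0 _)).
  by rewrite mulr_ge0 ?sqr_ge0 ?(ltW (c0 _)).
have Di0 i k : 0 <= b i * ((2 - g i - c i) * r i k.+1 ^+ 2
             + (1 - (1 - g i) ^+ 2 / c i) * (v i k.+1 - v i k) ^+ 2).
  by rewrite mulr_ge0 ?(ltW (b0 _))// addr_ge0// mulr_ge0 ?sqr_ge0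
    ?(ltW (rc _)) ?(ltW (dc _)).
have W0 k : 0 <= W k by apply: sumr_ge0.
have D0 k : 0 <= D k by apply: sumr_ge0.
(* Beyond W k, the coordinate estimates leave two sums: the difference of the
   two gap bounds, nonpositive by lo and up, and a term with the sign of mono. *)
have WD k : W k.+1 + D k <= W k.
  have : W k.+1 + D k <= W k
     + 2 * (\sum_i b i * (r i k.+1 ^+ 2 + u i k * r i k.+1
              + (v i k.+1 - v i k) * r i k.+1
              + (v i k.+1 - v i k) * (v i k.+1 - vs i))
            - \sum_i b i * (us i * r i k.+1))
     - 2 * \sum_i b i * ((r i k.+1 - (1 - g i) * r i k) * (v i k.+1 - v i k)).
    rewrite /W /D mulrBr !mulr_sumr -!big_split/= -!sumrB -!big_split/=.
    rewrite -sumrB; apply: ler_sum => i _; rewrite uS.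
    have := admm_coordinate_descent _ (g i) (c i) (us i) (vs i) (u i k)
      (r i k) (v i k) (r i k.+1) (v i k.+1) (g0 i) (c0 i).
    move=> /(ler_wpM2l (ltW (b0 i))) H.
    by rewrite -mulrDr; apply: (le_trans H); lra.
  have := mono k; have := lo k; have := up k; lra.
have [Dcvg Wle] := cvg0_descent _ _ _ W0 D0 WD.
have WiW i k : b i * ((u i k - us i) ^+ 2 / g i + (v i k - vs i) ^+ 2
                           + c i * r i k ^+ 2) <= W 0%N.
  apply: le_trans (Wle k); rewrite /W (bigD1 i)//= lerDl.
  by apply: sumr_ge0.
have DiD i k : b i * ((2 - g i - c i) * r i k.+1 ^+ 2
             + (1 - (1 - g i) ^+ 2 / c i) * (v i k.+1 - v i k) ^+ 2) <= D k.
  by rewrite /D (bigD1 i)//= lerDl; apply: sumr_ge0.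
have DZ K : D k * K @[k --> \oo] --> 0.
  by rewrite -(mul0r K); apply: cvgM => //; exact: cvg_cst.
have rS i : r i k.+1 @[k --> \oo] --> 0.
  apply: cvg0_sqr_le (DZ (b i * (2 - g i - c i))^-1) => k.
  rewrite ler_pdivlMr ?mulr_gt0//; apply: le_trans (DiD i k).
  rewrite mulrC -mulrA ler_pM2l// lerDl mulr_ge0 ?sqr_ge0//.
  exact: ltW.
have dS i : v i k.+1 - v i k @[k --> \oo] --> 0.
  apply: cvg0_sqr_le (DZ (b i * (1 - (1 - g i) ^+ 2 / c i))^-1) => k.
  rewrite ler_pdivlMr ?mulr_gt0//; apply: le_trans (DiD i k).
  rewrite mulrC -mulrA ler_pM2l// lerDr mulr_ge0 ?sqr_ge0//.
  exact: ltW.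
have uB i k : (u i k - us i) ^+ 2 <= W 0%N * (g i / b i).
  rewrite mulrA ler_pdivlMr// mulrC -ler_pdivrMr//; apply: le_trans (WiW i k).
  rewrite -mulrA ler_pM2l// -addrA lerDl.
  by rewrite addr_ge0 ?sqr_ge0// mulr_ge0 ?sqr_ge0// ltW.
have vB i k : (v i k - vs i) ^+ 2 <= W 0%N / b i.
  rewrite ler_pdivlMr// mulrC; apply: le_trans (WiW i k).
  rewrite ler_pM2l// addrAC lerDr.
  by rewrite addr_ge0// mulr_ge0 ?sqr_ge0 ?invr_ge0// ltW.
have rcvg i : r i @ \oo --> 0 by have := rS i; rewrite (@cvg_shiftS _ (r i)).
split=> //; rewrite -(@cvg_shiftS _ gap).
have cst0 (a : R) (w : R^nat) : w @ \oo --> 0 -> a * w k @[k --> \oo] --> 0.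
  by move=> w0; rewrite -(mulr0 a); apply: cvgM => //; exact: cvg_cst.
have dr i : (v i k.+1 - v i k) * r i k.+1 @[k --> \oo] --> 0.
  by rewrite -(mulr0 0); apply: cvgM.
have rr i : r i k.+1 ^+ 2 @[k --> \oo] --> 0.
  by rewrite -(mulr0 0); apply: cvgM.
have ur i : u i k * r i k.+1 @[k --> \oo] --> 0.
  rewrite (_ : (fun k => _) =
    fun k => (u i k - us i) * r i k.+1 + us i * r i k.+1); last first.
    by apply/funext => k; rewrite -mulrDl subrK.
  rewrite -(addr0 0); apply: cvgD; last exact: cst0.
  exact: (@cvg0_mul_bounded _ _ (fun k => u i k - us i) _ (uB i)).
have dv i : (v i k.+1 - v i k) * (v i k.+1 - vs i) @[k --> \oo] --> 0.
  rewrite (_ : (fun k => _) =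
    fun k => (v i k.+1 - vs i) * (v i k.+1 - v i k)); last first.
    by apply/funext => k; rewrite mulrC.
  by apply: (@cvg0_mul_bounded _ _ (fun k => v i k.+1 - vs i) _
              (fun k => vB i k.+1)).
apply: (@squeeze_cvgr _ _ _ _
  (fun k => - \sum_i b i * (us i * r i k.+1))
  (fun k => - \sum_i b i * (r i k.+1 ^+ 2 + u i k * r i k.+1
     + (v i k.+1 - v i k) * r i k.+1
     + (v i k.+1 - v i k) * (v i k.+1 - vs i)))).
- by apply: nearW => k; rewrite lo up.
- rewrite -[X in _ --> X]oppr0; apply: cvgN; apply: cvg0_sum => i; do 2 apply: (cst0).
  exact: rS.
- rewrite -[X in _ --> X]oppr0; apply: cvgN; apply: cvg0_sum => i; apply: cst0.
  rewrite -(addr0 0); apply: cvgD => //; rewrite -(addr0 0).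
  by apply: cvgD => //; rewrite -(addr0 0); apply: cvgD.
Qed.

(** * First-order optimality along segments *)

Lemma epigraph_segment_le (R : realType) (n : nat) (f : 'cV[R]_n -> \bar R)
    (x z : 'cV[R]_n) (a b t : R) :
  convex_set (epigraph f) -> f x = a%:E -> f z = b%:E -> 0 <= t <= 1 ->
  (f (x + t *: (z - x))%R <= (a + t * (b - a))%:E)%E.
Proof.
move=> cf fx fz /andP[t0 t1].
have xe : ((x, a) : 'cV[R]_n * R^o) \in epigraph f.
  by rewrite inE /epigraph/= fx.
have ze : ((z, b) : 'cV[R]_n * R^o) \in epigraph f.
  by rewrite inE /epigraph/= fz.
have := cf (z, b) (x, a) (Itv01 t0 t1) ze xe.
rewrite inE /epigraph/=.
congr (f _ <= _%:E)%E.
  by rewrite /= scalerBl scale1r scalerBr; rewrite addrCA.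
by rewrite /= /GRing.scale/= /unstable.onem; ring.
Qed.

Lemma convex_map_segment_le (R : realType) (n m : nat)
    (h : 'cV[R]_n -> 'cV[R]_m) (x z : 'cV[R]_n) (t : R) (j : 'I_m) :
  convex_map h -> 0 <= t <= 1 ->
  h (x + t *: (z - x)) j 0 <= h x j 0 + t * (h z j 0 - h x j 0).
Proof.
move=> ch /andP[t0 t1].
have := ch j (Itv01 t0 t1) z x; rewrite !inE => /(_ I I).
congr (_ <= _).
  congr (h _ j 0).
  by rewrite /conv/= scalerBl scale1r scalerBr addrCA.
transitivity (t * h z j 0 + (1 - t) * h x j 0); first by [].
by ring.
Qed.

(** The optimality condition 0 in subdiff f + grad Phi tested at z, obtained
    without subdifferential calculus: compare x with x + t (z - x), divide by t
    and let t tend to 0.  The number e stands for the directional derivative of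
    Phi; only a quadratic upper bound is required, so Phi may be a composition
    with a nonsmooth convex map. *)
Lemma minimizer_first_order (R : realType) (n : nat) (f : 'cV[R]_n -> \bar R)
    (Phi : 'cV[R]_n -> R) (x z : 'cV[R]_n) (a b e c : R) :
  convex_set (epigraph f) -> f x = a%:E -> f z = b%:E ->
  is_minimizer (fun w => f w + (Phi w)%:E)%E x ->
  (forall t, 0 <= t <= 1 ->
    Phi (x + t *: (z - x)) <= Phi x + t * e + t ^+ 2 * c) ->
  a <= b + e.
Proof.
move=> cf fx fz xmin hPhi; rewrite leNgt; apply/negP => lt_a.
pose q := a - b - e.
have q0 : 0 < q by rewrite /q; lra.
have dpos : 0 < q + 2 * `|c| by rewrite ltr_wpDr// mulr_ge0.
(* A step in ]0, 1] small enough that t c < q, with no case split on c = 0. *)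
pose t := q / (q + 2 * `|c|).
have t0 : 0 < t by rewrite divr_gt0.
have t1 : t <= 1 by rewrite ler_pdivrMr// mul1r lerDl mulr_ge0.
have t01 : 0 <= t <= 1 by rewrite ltW.
have := le_trans (xmin (x + t *: (z - x)))
  (leeD2r (Phi (x + t *: (z - x)))%:E (epigraph_segment_le _ _ _ _ _ _ _ _ cf fx fz t01)).
rewrite fx -!EFinD lee_fin => le1.
have le2 := hPhi _ t01.
have : t * q <= t * (t * c) by rewrite /q; nra.
rewrite ler_pM2l// leNgt => /negP; apply.
apply: (@le_lt_trans _ _ (t * `|c|)); first by rewrite ler_wpM2l ?ler_norm// ltW.
rewrite /t mulrAC ltr_pdivrMr// ltr_pM2l//.
have := normr_ge0 c; lra.
Qed.

Lemma penalized_minimizer_first_order (R : realType) (n : nat) (I : finType)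
    (f : 'cV[R]_n -> \bar R) (w : I -> R) (phi : I -> 'cV[R]_n -> R)
    (x z : 'cV[R]_n) (a b : R) (p e : I -> R) :
  convex_set (epigraph f) -> f x = a%:E -> f z = b%:E ->
  (forall i, 0 < w i) ->
  is_minimizer (fun y => f y + (\sum_i w i / 2 * phi i y ^+ 2)%:E)%E x ->
  (forall i t, 0 <= t <= 1 ->
    phi i (x + t *: (z - x)) ^+ 2 <= (p i + t * e i) ^+ 2) ->
  (forall i, phi i x = p i) ->
  a <= b + \sum_i w i * (p i * e i).
Proof.
move=> cf fx fz w0 xmin hphi phix.
apply: (minimizer_first_order _ _ _ _ _ _ _ _ _ (\sum_i w i / 2 * e i ^+ 2) cf
  fx fz xmin) => t t01.
rewrite !mulr_sumr -!big_split/=; apply: ler_sum => i _.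
have /ler_wpM2l H := hphi i t t01.
have w20 : 0 <= w i / 2 by have := w0 i; lra.
by apply: le_trans (H _ w20) _; rewrite phix le_eqVlt; apply/orP; left;
  apply/eqP; field.
Qed.

(** The right-hand side is an upper quadratic model of a |-> [a]_+^2 at b.  As
    this function is nondecreasing, the model also holds along a convex h, where
    the increment of the argument is only bounded above by c. *)
Lemma max0_sqr_le (R : realType) (a b c : R) :
  a <= b + c -> Num.max a 0 ^+ 2 <= (Num.max b 0 + c) ^+ 2.
Proof.
move=> abc; have [a0|a0] := leP a 0; first by rewrite expr0n/= sqr_ge0.
by rewrite ler_pXn2r ?nnegrE ?(ltW a0)//; case: (leP b 0) => b0; lra.
Qed.

Lemma minimizer_fin (R : realType) (n : nat) (f : 'cV[R]_n -> \bar R)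
    (Phi : 'cV[R]_n -> R) (x : 'cV[R]_n) :
  Defs.proper f -> is_minimizer (fun w => f w + (Phi w)%:E)%E x ->
  f x = (fine (f x))%:E.
Proof.
move=> [fN [z fz]] /(_ z) xmin; rewrite fineK//.
move: (fN x) (fN z) fz xmin; rewrite fin_numE => -> /=.
by case: (f z) => [r||]//; case: (f x).
Qed.

Lemma subdifferential_fin (R : realType) (n : nat) (f : 'cV[R]_n -> \bar R)
    (x v : 'cV[R]_n) :
  Defs.proper f -> subdifferential f x v -> f x = (fine (f x))%:E.
Proof.
move=> [fN [z fz]] /(_ z) sub; rewrite fineK//.
move: (fN x) (fN z) fz sub; rewrite fin_numE => -> /=.
by case: (f z) => [r||]//; case: (f x).
Qed.

(** * Euclidean structure *)

Lemma dotvDl (R : realType) (n : nat) (u v w : 'cV[R]_n) :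
  dotv (u + v) w = dotv u w + dotv v w.
Proof. by rewrite /dotv -big_split; apply: eq_bigr => i _; rewrite mxE mulrDl. Qed.

Lemma dotvZl (R : realType) (n : nat) (a : R) (u w : 'cV[R]_n) :
  dotv (a *: u) w = a * dotv u w.
Proof. by rewrite /dotv mulr_sumr; apply: eq_bigr => i _; rewrite mxE mulrA. Qed.

Lemma dotv_adj (R : realType) (n m : nat) (M : 'M[R]_(m, n)) (u : 'cV[R]_m)
    (z : 'cV[R]_n) :
  dotv (M^T *m u) z = dotv u (M *m z).
Proof.
rewrite /dotv; under eq_bigr do rewrite mxE mulr_suml.
rewrite exchange_big; apply: eq_bigr => j _; rewrite mxE mulr_sumr.
by apply: eq_bigr => i _; rewrite mxE; ring.
Qed.

Lemma norm2_sqr (R : realType) (n : nat) (v : 'cV[R]_n) :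
  norm2 v ^+ 2 = \sum_i v i 0 ^+ 2.
Proof.
rewrite sqr_sqrtr; last by apply: sumr_ge0 => i _; rewrite -expr2 sqr_ge0.
by [].
Qed.

(** * The two constraint blocks as one family of coordinates *)

Definition weight {R : realType} {m1 m2 : nat} (a b : R)
  (i : 'I_m1 + 'I_m2) : R := if i is inl _ then a else b.

Definition stack {R : realType} {m1 m2 : nat} (a : 'cV[R]_m1) (b : 'cV[R]_m2)
    (i : 'I_m1 + 'I_m2) : R :=
  match i with inl j => a j 0 | inr j => b j 0 end.

Lemma stack_penaltyE (R : realType) (m1 m2 : nat) (b1 b2 : R)
    (a : 'cV[R]_m1) (b : 'cV[R]_m2) :
  b1 / 2 * norm2 a ^+ 2 + b2 / 2 * norm2 b ^+ 2 =
  \sum_i weight b1 b2 i / 2 * stack a b i ^+ 2.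
Proof. by rewrite big_sumType/= !norm2_sqr !mulr_sumr. Qed.

(** * Lower bound on the objective gap *)

(** The KKT point minimizes the Lagrangian at the multiplier u*.  The slack
    s can be added to the residual because u1* >= 0, and h(xs) may be traded for
    B ys by complementary slackness. *)
Lemma KKT_gap_lower_bound (R : realType) (n1 n2 m1 m2 : nat)
    (f : 'cV[R]_n1 -> \bar R) (g : 'cV[R]_n2 -> \bar R)
    (h : 'cV[R]_n1 -> 'cV[R]_m1) (A : 'M[R]_(m2, n1)) (B : 'M[R]_(m1, n2))
    (C : 'M[R]_(m2, n2)) (d : 'cV[R]_m2) (b1 b2 : R)
    (xs x : 'cV[R]_n1) (ys y : 'cV[R]_n2) (u1s s : 'cV[R]_m1) (u2s : 'cV[R]_m2)
    (fxs fx gys gy : R) :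
  KKT f g h A B C d b1 b2 xs ys u1s u2s -> 0 < b1 -> lev 0 s ->
  f xs = fxs%:E -> f x = fx%:E -> g ys = gys%:E -> g y = gy%:E ->
  - \sum_i weight b1 b2 i *
      (stack u1s u2s i *
       stack (h x + s - B *m y) (A *m x + C *m y - d) i)
  <= fx + gy - (fxs + gys).
Proof.
move=> [[v [J [fv hJ v0]]] [w gw w0] _ eqs dual slack] b10 s0 fxsE fxE gysE gyE.
have fle : fxs + dotv v (x - xs) <= fx.
  by rewrite -lee_fin EFinD -fxsE -fxE; exact: fv.
have gle : gys + dotv w (y - ys) <= gy.
  by rewrite -lee_fin EFinD -gysE -gyE; exact: gw.
have vE : v = - b1 *: (J^T *m u1s) + - b2 *: (A^T *m u2s).
  apply/eqP; rewrite !scaleNr -opprD -addr_eq0 addrA; apply/eqP.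
  by rewrite v0.
have wE : w = b1 *: (B^T *m u1s) + - b2 *: (C^T *m u2s).
  apply/eqP; rewrite scaleNr -subr_eq0 opprB addrA; apply/eqP.
  by rewrite w0 addrAC.
have hle j : (J *m (x - xs)) j 0 <= h x j 0 - h xs j 0.
  have := hJ j x; rewrite -EFinD lee_fin -lerBrDl; congr (_ <= _).
  by rewrite /dotv mxE; apply: eq_bigr => i _; rewrite !mxE.
suff : - \sum_i weight b1 b2 i *
      (stack u1s u2s i *
       stack (h x + s - B *m y) (A *m x + C *m y - d) i)
   <= dotv v (x - xs) + dotv w (y - ys) by lra.
rewrite vE wE !(dotvDl, dotvZl) !dotv_adj /dotv big_sumType/= !mulr_sumr.
rewrite -eqs !mulmxBr opprD addrACA -!big_split/= -!sumrN lerD//.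
  apply: ler_sum => j _.
  have {}slack : u1s j 0 * (h xs j 0 - (B *m ys) j 0) = 0.
    by move/matrixP: slack => /(_ j 0); rewrite !mxE.
  have uj : 0 <= u1s j 0 by have := dual j; rewrite mxE.
  have sj : 0 <= s j 0 by have := s0 j; rewrite mxE.
  have := ler_wpM2l (ltW b10) (ler_wpM2l uj (hle j)).
  have := ler_wpM2l (ltW b10) (mulr_ge0 uj sj).
  have : b1 * (u1s j 0 * (h xs j 0 - (B *m ys) j 0)) = 0 by rewrite slack mulr0.
  rewrite mulmxBr; move: (J *m x) (J *m xs) (B *m y) (B *m ys) => Jx Jxs By Bys.
  rewrite !mxE; lra.
apply: ler_sum => j _.
move: (A *m x) (A *m xs) (C *m y) (C *m ys) => Ax Axs Cy Cys.
rewrite !mxE; lra.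
Qed.

(** * Optimality of the two subproblems *)

Lemma x_step_optimality (R : realType) (n m1 m2 : nat)
    (f : 'cV[R]_n -> \bar R) (h : 'cV[R]_n -> 'cV[R]_m1) (A : 'M[R]_(m2, n))
    (b1 b2 : R) (c1 : 'cV[R]_m1) (c2 : 'cV[R]_m2) (x z : 'cV[R]_n) (a b : R) :
  convex_set (epigraph f) -> convex_map h -> 0 < b1 -> 0 < b2 ->
  f x = a%:E -> f z = b%:E ->
  is_minimizer (fun y => f y + (b1 / 2 * norm2 (posv (h y + c1)) ^+ 2
                              + b2 / 2 * norm2 (A *m y + c2) ^+ 2)%:E)%E x ->
  a <= b + \sum_i weight b1 b2 i *
     (stack (posv (h x + c1)) (A *m x + c2) i *
      stack (h z - h x) (A *m z - A *m x) i).
Proof.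
move=> cf ch b10 b20 fx fz xmin.
apply: (penalized_minimizer_first_order _ _ _ f _
  (fun i y => stack (posv (h y + c1)) (A *m y + c2) i) x z) => //.
- by case.
- by move=> y; rewrite -!stack_penaltyE; exact: xmin.
case=> j t t01 /=.
  rewrite !mxE max0_sqr_le//.
  by have := convex_map_segment_le _ _ _ h x z t j ch t01; lra.
rewrite mulmxDr -scalemxAr mulmxBr; move: (A *m x) (A *m z) => Ax Az.
by rewrite !mxE le_eqVlt; apply/orP; left; apply/eqP; ring.
Qed.

(** The residuals p and q are given by their increments in w, so that any
    arrangement of the constant terms fits. *)
Lemma y_step_optimality (R : realType) (n m1 m2 : nat)
    (g : 'cV[R]_n -> \bar R) (B : 'M[R]_(m1, n)) (C : 'M[R]_(m2, n))
    (b1 b2 : R) (p : 'cV[R]_n -> 'cV[R]_m1) (q : 'cV[R]_n -> 'cV[R]_m2)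
    (y z : 'cV[R]_n) (a b : R) :
  convex_set (epigraph g) -> 0 < b1 -> 0 < b2 ->
  g y = a%:E -> g z = b%:E ->
  (forall w, p w = p y - (B *m w - B *m y)) ->
  (forall w, q w = q y + (C *m w - C *m y)) ->
  is_minimizer (fun w => g w + (b1 / 2 * norm2 (p w) ^+ 2
                              + b2 / 2 * norm2 (q w) ^+ 2)%:E)%E y ->
  a <= b + \sum_i weight b1 b2 i *
     (stack (p y) (q y) i *
      (stack (B *m y) (- (C *m y)) i
       - stack (B *m z) (- (C *m z)) i)).
Proof.
move=> cg b10 b20 gy gz pE qE ymin.
apply: (penalized_minimizer_first_order _ _ _ g _
  (fun i w => stack (p w) (q w) i) y z) => //.
- by case.
- by move=> w; rewrite -!stack_penaltyE; exact: ymin.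
case=> j t t01 /=.
  rewrite pE mulmxDr -scalemxAr mulmxBr; move: (B *m y) (B *m z) => By Bz.
  by rewrite !mxE le_eqVlt; apply/orP; left; apply/eqP; ring.
rewrite qE mulmxDr -scalemxAr mulmxBr; move: (C *m y) (C *m z) => Cy Cz.
by rewrite !mxE le_eqVlt; apply/orP; left; apply/eqP; ring.
Qed.

(** One inequality coordinate of the upper bound on the gap.  With
    w = hx - c + u, the multiplier [w]_+ and the slack [-w]_+ are complementary
    and [w]_+ - [-w]_+ = w; feasibility hs <= cs is used against [w]_+ >= 0. *)
Lemma complementary_slack_step (R : realType) (hx hs c c' cs u : R) :
  hs <= cs ->
  Num.max (hx + (- c + u)) 0 * (hs - hx)
  + (hx + Num.max (- hx + c - u) 0 - c' + u) * (c' - cs)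
  <= - ((hx + Num.max (- hx + c - u) 0 - c') ^+ 2
        + u * (hx + Num.max (- hx + c - u) 0 - c')
        + (c' - c) * (hx + Num.max (- hx + c - u) 0 - c')
        + (c' - c) * (c' - cs)).
Proof.
move=> hcs; have [w0|w0] := leP (hx + (- c + u)) 0.
  rewrite max_l; last by lra.
  by rewrite le_eqVlt; apply/orP; left; apply/eqP; ring.
rewrite max_r; last by lra.
have := ler_wpM2l (ltW w0) hcs; lra.
Qed.

(** * Convergence of the iteration *)

Theorem theorem3p3 (R : realType) (n1 n2 m1 m2 : nat)
  (f : 'cV[R]_n1 -> \bar R) (g : 'cV[R]_n2 -> \bar R)
  (h : 'cV[R]_n1 -> 'cV[R]_m1)
  (A : 'M[R]_(m2, n1)) (B : 'M[R]_(m1, n2)) (C : 'M[R]_(m2, n2))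
  (d : 'cV[R]_m2) (beta1 beta2 gamma1 gamma2 : R)
  (xs : 'cV[R]_n1) (ys : 'cV[R]_n2) (u1s : 'cV[R]_m1) (u2s : 'cV[R]_m2)
  (x : nat -> 'cV[R]_n1) (s : nat -> 'cV[R]_m1) (y : nat -> 'cV[R]_n2)
  (u1 : nat -> 'cV[R]_m1) (u2 : nat -> 'cV[R]_m2)
  (hf : proper_closed_convex f) (hg : proper_closed_convex g)
  (hh : convex_map h)
  (hbeta1 : 0 < beta1) (hbeta2 : 0 < beta2)
  (hgamma1 : 0 < gamma1 < (1 + Num.sqrt 5) / 2)
  (hgamma2 : 0 < gamma2 < (1 + Num.sqrt 5) / 2)
  (hkkt : KKT f g h A B C d beta1 beta2 xs ys u1s u2s)
  (hseq : NLADMM f g h A B C d beta1 beta2 gamma1 gamma2 x s y u1 u2) :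
  ((fun k => norm2 (posv (h (x k) - B *m y k))
             + norm2 (A *m x k + C *m y k - d)) @ \oo --> (0 : R)) /\
  ((fun k => (f (x k) + g (y k)) - (f xs + g ys))%E @ \oo --> (0 : \bar R)%E).
Proof.
have [fprop _ fconv] := hf; have [gprop _ gconv] := hg.
have [_ xmin sE ymin u1E u2E] := hseq.
have [[vf [J [fsub _ _]]] [wg gsub _] ineqs eqs _ _] := hkkt.
have fE k : f (x k.+1) = (fine (f (x k.+1)))%:E by exact: minimizer_fin (xmin k).
have gE k : g (y k.+1) = (fine (g (y k.+1)))%:E by exact: minimizer_fin (ymin k).
have fsE : f xs = (fine (f xs))%:E by exact: subdifferential_fin fsub.
have gsE : g ys = (fine (g ys))%:E by exact: subdifferential_fin gsub.
pose st := @stack R m1 m2.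
pose b := @weight R m1 m2 beta1 beta2.
pose gam := @weight R m1 m2 gamma1 gamma2.
pose r i k := st (h (x k) + s k - B *m y k) (A *m x k + C *m y k - d) i.
pose u i k := st (u1 k) (u2 k) i.
pose v i k := st (B *m y k) (- (C *m y k)) i.
pose us := st u1s u2s.
pose vs := st (B *m ys) (- (C *m ys)).
pose gap k := fine (f (x k)) + fine (g (y k)) - (fine (f xs) + fine (g ys)).
have s0 k : lev 0 (s k.+1) by move=> j; rewrite sE !mxE le_max lexx orbT.
have uS i k : u i k.+1 = u i k + gam i * r i k.+1.
  by rewrite /u /r; case: i => j /=; rewrite ?u1E ?u2E !mxE.
have yopt k z c : g z = c%:E -> fine (g (y k.+1)) <= c +
    \sum_i b i * ((r i k.+1 + u i k)
                  * (v i k.+1 - st (B *m z) (- (C *m z)) i)).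
  move=> gz; have := y_step_optimality _ _ _ _ _ B C _ _
    (fun w => h (x k.+1) + s k.+1 - B *m w + u1 k)
    (fun w => A *m x k.+1 + C *m w - d + u2 k)
    _ _ _ _ gconv hbeta1 hbeta2 (gE k) gz _ _ (ymin k).
  move=> /(_ _ _)/le_trans; apply.
  - by move=> w; apply/matrixP => i j; rewrite !mxE; ring.
  - by move=> w; apply/matrixP => i j; rewrite !mxE; ring.
  - rewrite le_eqVlt; apply/orP; left; apply/eqP; congr (_ + _).
    by apply: eq_bigr => -[j|j] _; rewrite /r /u /v /st /=; rewrite !mxE.
have mono k : 0 <= \sum_i b i * ((r i k.+2 - (1 - gam i) * r i k.+1)
                                 * (v i k.+2 - v i k.+1)).
  have := yopt k.+1 _ _ (gE k); have := yopt k _ _ (gE k.+1).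
  suff -> : \sum_i b i * ((r i k.+2 - (1 - gam i) * r i k.+1)
                                 * (v i k.+2 - v i k.+1)) =
    \sum_i b i * ((r i k.+2 + u i k.+1) * (v i k.+2 - v i k.+1)) +
    \sum_i b i * ((r i k.+1 + u i k) * (v i k.+1 - v i k.+2)).
    rewrite -/(v _ _); lra.
  by rewrite -big_split/=; apply: eq_bigr => i _; rewrite uS; ring.
have lo k : - \sum_i b i * (us i * r i k.+1) <= gap k.+1.
  exact: KKT_gap_lower_bound hkkt hbeta1 (s0 k) fsE (fE k) gsE (gE k).
have up k : gap k.+1 <= - \sum_i b i *
     (r i k.+1 ^+ 2 + u i k * r i k.+1 + (v i k.+1 - v i k) * r i k.+1
      + (v i k.+1 - v i k) * (v i k.+1 - vs i)).
  have ygap := yopt k _ _ gsE.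
  have xmin' : is_minimizer (fun z => f z
       + (beta1 / 2 * norm2 (posv (h z + (- (B *m y k) + u1 k))) ^+ 2
          + beta2 / 2 * norm2 (A *m z + (C *m y k - d + u2 k)) ^+ 2)%:E)%E
    (x k.+1) by move=> z; rewrite !addrA; exact: xmin.
  have xgap := x_step_optimality _ _ _ _ _ _ _ _ _ _ _ _ _ _ _
    fconv hh hbeta1 hbeta2 (fE k) fsE xmin'.
  suff : \sum_i b i * (st (posv (h (x k.+1) + (- (B *m y k) + u1 k)))
       (A *m x k.+1 + (C *m y k - d + u2 k)) i *
       st (h xs - h (x k.+1)) (A *m xs - A *m x k.+1) i)
     + \sum_i b i * ((r i k.+1 + u i k) * (v i k.+1 - vs i))
     <= - \sum_i b i *
     (r i k.+1 ^+ 2 + u i k * r i k.+1 + (v i k.+1 - v i k) * r i k.+1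
      + (v i k.+1 - v i k) * (v i k.+1 - vs i)).
    by move: ygap xgap; rewrite /gap -/st -/b -/(vs _); lra.
  rewrite -big_split/= -sumrN; apply: ler_sum => -[j|j] _ /=.
    have := ineqs j; have := sE k; move/matrixP => /(_ j 0).
    rewrite /r /u /v /vs /st /=.
    move: (B *m y k) (B *m y k.+1) (B *m ys) => By By' Bys.
    rewrite !mxE -mulrDr -mulrN => -> hys.
    rewrite ler_pM2l//.
    exact: complementary_slack_step.
  rewrite /r /u /v /vs /st /=.
  have := eqs; move/matrixP => /(_ j 0).
  move: (A *m x k.+1) (A *m xs) (C *m y k) (C *m y k.+1) (C *m ys).
  move=> Ax Axs Cy Cy' Cys; rewrite !mxE => <-.
  by rewrite le_eqVlt; apply/orP; left; apply/eqP; ring.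
have b0 i : 0 < b i by case: i.
have g0 i : 0 < gam i by case: i => _ /=; case/andP: hgamma1; case/andP: hgamma2.
have gl i : (1 - gam i) ^+ 2 < 2 - gam i by case: i => j; exact: golden_ratio_sqr.
(* Shifted by one: the initial y 0 minimizes nothing, so mono starts at k = 1. *)
have [rS gapS] := admm_lyapunov _ _ b gam us vs
  (fun i k => u i k.+1) (fun i k => v i k.+1) (fun i k => r i k.+1)
  (fun k => gap k.+1) b0 g0 gl (fun i k => uS i k.+1) mono
  (fun k => lo k.+1) (fun k => up k.+1).
split.
  have rr : (fun k => \sum_i r i k.+1 ^+ 2) @ \oo --> 0.
    by apply: cvg0_sum => i; rewrite -(mulr0 0); exact: cvgM.
  have ineq0 : norm2 (posv (h (x k.+1) - B *m y k.+1)) @[k --> \oo] --> 0.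
    apply: cvg0_sqr_le rr => k.
    rewrite norm2_sqr big_sumType/= -[leLHS]addr0 lerD//; last first.
      by apply: sumr_ge0 => j _; exact: sqr_ge0.
    (* As s >= 0, the positive part of h(x) - B y is at most |r|. *)
    apply: ler_sum => j _; rewrite /r/=.
    have := s0 k j; move: (B *m y k.+1) => By; rewrite !mxE => sj.
    have [_|pos] := leP (h (x k.+1) j 0 - By j 0) 0.
      by rewrite expr0n/= sqr_ge0.
    by rewrite ler_pXn2r ?nnegrE//; lra.
  have eq0 : norm2 (A *m x k.+1 + C *m y k.+1 - d) @[k --> \oo] --> 0.
    apply: cvg0_sqr_le rr => k.
    rewrite norm2_sqr big_sumType/= -[leLHS]add0r lerD//.
    by apply: sumr_ge0 => j _; exact: sqr_ge0.
  have := cvgD ineq0 eq0 => /(_ eventually_filter); rewrite addr0.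
  by rewrite (@cvg_shiftS _ (fun k => norm2 (posv (h (x k) - B *m y k))
    + norm2 (A *m x k + C *m y k - d))).
rewrite -(@cvg_shiftS _ (fun k => (f (x k) + g (y k)) - (f xs + g ys))%E).
rewrite (_ : [sequence _]_n = EFin \o (fun k => gap k.+1)); last first.
  by apply/funext => k /=; rewrite fE gE fsE gsE.
apply: cvg_EFin => //; exact: nearW.
Qed.
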